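(* The price of anarchy and the bicriteria are in general unbounded in mixed autonomy. That is, for every real number $M$ there exists a mixed-autonomy routing game (a network with demands of human-driven and autonomous flow and road latency functions $c_i(x_i,y_i)$ that are nonnegative and nondecreasing in each argument) whose price of anarchy is greater than $M$ and whose bicriteria is greater than $M$.
   Context: Mixed-autonomy routing game: a directed network with $n$ roads (links) and $m$ origin-destination pairs; the $j$-th pair has demand $\alpha_j\ge 0$ of human-driven flow and $\beta_j\ge 0$ of autonomous flow. Drivers are nonatomic (each controls an infinitesimal amount of flow). A routing is a vector $z=(x_1,y_1,\ldots,x_n,y_n)\in\mathbb{R}_{\ge 0}^{2n}$, where $x_i$ and $y_i$ are the human-driven and autonomous flows on road $i$; it is feasible if it routes all demand of both types from origins to destinations, respecting conservation of flow for each type. Both vehicle types on road $i$ experience the latency $c_i(x_i,y_i)$. The social cost is $C(z)=\sum_{i=1}^n c_i(x_i,y_i)(x_i+y_i)$. A (Wardrop) equilibrium is a feasible routing in which all users sharing an origin and destination use paths of equal latency and no unused path has smaller latency. A social optimum is a feasible routing minimizing $C$. Price of anarchy of a game: the ratio between the social cost of a worst-case (largest social cost) equilibrium and the social cost of a social optimum. Bicriteria of a game: the factor $\gamma$ such that a social optimum for the game in which every demand (of each type) is multiplied by $\gamma$ has the same social cost as a worst-case equilibrium for the original demands. *)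

(* Defs.v *)
From HB Require Import structures.
From mathcomp Require Import all_boot all_order all_algebra.
From mathcomp Require Import reals.

Set Implicit Arguments.
Unset Strict Implicit.
Unset Printing Implicit Defensive.

Import Order.TTheory GRing.Theory Num.Theory.
Local Open Scope ring_scope.

(* A mixed-autonomy routing game on a directed multigraph with nodes V, roads
   'I_n and origin-destination pairs 'I_m; parallel roads are allowed. *)
Record mixed_game (R : realType) (V : finType) (n m : nat) := MixedGame {
  road_src : 'I_n -> V;
  road_dst : 'I_n -> V;
  origin : 'I_m -> V;
  destination : 'I_m -> V;
  human_demand : 'I_m -> R;
  auto_demand : 'I_m -> R;
  latency : 'I_n -> R -> R -> R
}.

(* Latencies only matter on the nonnegative quadrant. *)
Definition admissible (R : realType) (V : finType) (n m : nat)
    (G : mixed_game R V n m) : Prop :=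
  [/\ forall j, 0 <= human_demand G j /\ 0 <= auto_demand G j,
      forall i x y, 0 <= x -> 0 <= y -> 0 <= latency G i x y,
      forall i x x' y, 0 <= x -> x <= x' -> 0 <= y ->
        latency G i x y <= latency G i x' y
    & forall i x y y', 0 <= x -> 0 <= y -> y <= y' ->
        latency G i x y <= latency G i x y'].

Definition scale_demand (R : realType) (V : finType) (n m : nat) (g : R)
    (G : mixed_game R V n m) : mixed_game R V n m :=
  MixedGame (road_src G) (road_dst G) (origin G) (destination G)
    (fun j => g * human_demand G j) (fun j => g * auto_demand G j) (latency G).

Section Routing.
Variables (R : realType) (V : finType) (n m : nat) (G : mixed_game R V n m).

Fixpoint walk (u v : V) (p : seq 'I_n) : bool :=
  if p is i :: q then (road_src G i == u) && walk (road_dst G i) v q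
  else u == v.

(* Paths visit each node at most once, so they have at most n roads and lie in
   the finite type n.-bseq 'I_n. *)
Definition od_path (j : 'I_m) (p : n.-bseq 'I_n) : bool :=
  walk (origin G j) (destination G j) p
  && uniq (origin G j :: [seq road_dst G i | i <- p]).

(* z i is the pair (x_i, y_i) of human-driven and autonomous flows. *)
Definition routing : Type := 'I_n -> R * R.

(* The flow of one vehicle type, by origin-destination pair and path; values
   off the paths of the pair are ignored. *)
Definition path_flow : Type := 'I_m -> n.-bseq 'I_n -> R.

Definition meets_demand (d : 'I_m -> R) (f : path_flow) : Prop :=
  forall j, (forall p, od_path j p -> 0 <= f j p)
            /\ \sum_(p | od_path j p) f j p = d j.

Definition road_flow (f : path_flow) (i : 'I_n) : R :=
  \sum_j \sum_(p | od_path j p && (i \in val p)) f j p.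

(* Conservation of flow, for each type, is built in: road flows are sums of
   flows along origin-destination paths. *)
Definition realizes (f h : path_flow) (z : routing) : Prop :=
  [/\ meets_demand (human_demand G) f, meets_demand (auto_demand G) h
    & forall i, z i = (road_flow f i, road_flow h i)].

Definition feasible (z : routing) : Prop := exists f h, realizes f h z.

Definition road_latency (z : routing) (i : 'I_n) : R :=
  latency G i (z i).1 (z i).2.

Definition path_latency (z : routing) (p : seq 'I_n) : R :=
  \sum_(i <- p) road_latency z i.

Definition social_cost (z : routing) : R :=
  \sum_(i < n) road_latency z i * ((z i).1 + (z i).2).

Definition used (f h : path_flow) (j : 'I_m) (p : n.-bseq 'I_n) : bool :=
  (0 < f j p) || (0 < h j p).

Definition equilibrium (z : routing) : Prop :=
  exists f h, realizes f h z /\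
    forall j p q, od_path j p -> od_path j q -> used f h j p ->
      (used f h j q -> path_latency z p = path_latency z q)
      /\ (~~ used f h j q -> path_latency z p <= path_latency z q).

Definition worst_equilibrium (z : routing) : Prop :=
  equilibrium z
  /\ forall z', equilibrium z' -> social_cost z' <= social_cost z.

Definition social_optimum (z : routing) : Prop :=
  feasible z /\ forall z', feasible z' -> social_cost z <= social_cost z'.

(* The positivity condition makes the ratio a genuine one: in R, x / 0 = 0. *)
Definition is_price_of_anarchy (rho : R) : Prop :=
  exists ze zo, [/\ worst_equilibrium ze, social_optimum zo,
    0 < social_cost zo & rho = social_cost ze / social_cost zo].

End Routing.

Definition bicriteria_factor (R : realType) (V : finType) (n m : nat)
    (G : mixed_game R V n m) (g : R) : Prop :=
  0 <= g /\ exists ze zo,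
    [/\ worst_equilibrium G ze, social_optimum (scale_demand g G) zo
      & social_cost (scale_demand g G) zo = social_cost G ze].

(* "The" factor: it must be the only one. *)
Definition is_bicriteria (R : realType) (V : finType) (n m : nat)
    (G : mixed_game R V n m) (g : R) : Prop :=
  unique (bicriteria_factor G) g.

(* Main.v *)
Require Import Defs.
From mathcomp Require Import all_boot all_order all_algebra.
From mathcomp Require Import reals.
From mathcomp Require Import lra.
Local Open Scope ring_scope.

(** The price of anarchy is unbounded because human and autonomous flow can
    congest a road to different degrees.  Take two parallel roads and one
    origin-destination pair with a unit of each type.  On the first road only
    human drivers cause delay, on the second only autonomous ones:
    [c_1(x, y) = 1 + K x] and [c_2(x, y) = 1 + K y].

    If every vehicle takes the road on which its own type causes the delay,
    both roads have latency [1 + K].  This is an equilibrium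
    ([separated_equilibrium]), and no feasible routing costs more, since a road
    carries at most one unit of the type that delays it.  If instead the two
    types are exchanged, no delay occurs: every latency is [1], the least
    possible.  So with demand [d] of each type the optimal cost is [2 d]
    ([exchanged_optimum]), while the worst equilibrium for unit demands costs
    [2 (1 + K)] ([separated_worst]).  The optimal cost being linear in the
    demand, the price of anarchy and the bicriteria are both exactly [1 + K],
    and [K] is arbitrary. *)

Set Implicit Arguments.
Unset Strict Implicit.
Unset Printing Implicit Defensive.

Import Order.TTheory GRing.Theory Num.Theory.

Section TwoRoads.
Variables (R : realType) (K : R).
Hypothesis K_ge0 : 0 <= K.

Definition two_road_game (d : R) : mixed_game R bool 2 1 :=
  MixedGame (fun _ => false) (fun _ => true) (fun _ => false) (fun _ => true)
    (fun _ => d) (fun _ => d)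
    (fun i x y => 1 + K * (if i == ord0 then x else y)).

Definition road_path (i : 'I_2) : 2.-bseq 'I_2 := @Bseq 2 _ [:: i] isT.

Lemma od_path_two_road d j (p : 2.-bseq 'I_2) :
  od_path (two_road_game d) j p =
  (p == road_path ord0) || (p == road_path ord_max).
Proof.
rewrite /od_path -!val_eqE /=; case: p => [[|i [|k s]] le_p] //=.
  by rewrite !eqseq_cons !andbT; case: i {le_p} => [[|[|]]].
by rewrite !eqseq_cons !andbF.
Qed.

(** Path sums become sums over the two roads, which turns feasibility into
    equations between road flows. *)
Lemma sum_od_path d j (Q : pred (2.-bseq 'I_2)) (F : 2.-bseq 'I_2 -> R) :
  \sum_(p | od_path (two_road_game d) j p && Q p) F p =
  \sum_(i | Q (road_path i)) F (road_path i).
Proof.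
rewrite (eq_bigl _ _ (fun p => congr1 (andb^~ (Q p)) (od_path_two_road d j p))).
rewrite big_mkcondr /= [RHS]big_mkcond /= big_ord_recl big_ord1.
rewrite (bigD1 (road_path ord0)) //= (bigD1 (road_path ord_max)) //=.
rewrite [X in _ + (_ + X)]big1 ?addr0.
  by congr (_ + _); rewrite (_ : ord_max = lift ord0 ord0) //; apply: val_inj.
by move=> p /andP[/andP[/orP[]/eqP -> ]]; rewrite ?eqxx.
Qed.

Lemma road_flow_two_road d f i :
  road_flow (two_road_game d) f i = f ord0 (road_path i).
Proof.
rewrite /road_flow big_ord1 sum_od_path (big_pred1 i) // => k /=.
by rewrite inE eq_sym.
Qed.

Lemma meets_demand_two_road d e (f : path_flow R 2 1) :
  meets_demand (two_road_game d) (fun _ => e) f <->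
  [/\ 0 <= f ord0 (road_path ord0), 0 <= f ord0 (road_path ord_max)
    & f ord0 (road_path ord0) + f ord0 (road_path ord_max) = e].
Proof.
have sumE : \sum_(p | od_path (two_road_game d) ord0 p) f ord0 p =
    f ord0 (road_path ord0) + f ord0 (road_path ord_max).
  rewrite (eq_bigl _ _ (fun p => esym (andbT (od_path _ ord0 p)))).
  rewrite (sum_od_path d ord0 predT) big_ord_recl big_ord1.
  by congr (_ + f _ (road_path _)); apply: val_inj.
split=> [/(_ ord0)[f_ge0 f_sum]|[f0 f1 f_sum] j].
  by split; rewrite -?sumE //; apply: f_ge0; rewrite od_path_two_road eqxx ?orbT.
rewrite (ord1 j) sumE; split=> // p.
by rewrite od_path_two_road => /orP[]/eqP->.
Qed.

(** The paths of the pair are the one-road paths, so a path flow is recovered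
    from road flows by reading the first road; the default value of [head]
    concerns only the empty sequence, which is not such a path. *)
Definition flow_of (x : 'I_2 -> R) : path_flow R 2 1 :=
  fun _ p => x (head ord0 (val p)).

Lemma realizes_flow_of d (z : routing R 2) :
    [/\ 0 <= (z ord0).1, 0 <= (z ord_max).1
      & (z ord0).1 + (z ord_max).1 = d] ->
    [/\ 0 <= (z ord0).2, 0 <= (z ord_max).2
      & (z ord0).2 + (z ord_max).2 = d] ->
  realizes (two_road_game d) (flow_of (fun i => (z i).1))
    (flow_of (fun i => (z i).2)) z.
Proof.
move=> zx zy; split=> [||i]; try exact/meets_demand_two_road.
by rewrite !road_flow_two_road -surjective_pairing.
Qed.

Lemma feasible_flows d (z : routing R 2) : feasible (two_road_game d) z ->
  [/\ 0 <= (z ord0).1, 0 <= (z ord_max).1 & (z ord0).1 + (z ord_max).1 = d]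
  /\ [/\ 0 <= (z ord0).2, 0 <= (z ord_max).2
       & (z ord0).2 + (z ord_max).2 = d].
Proof.
move=> [f [h [/meets_demand_two_road f_d /meets_demand_two_road h_d zE]]].
by rewrite !zE !road_flow_two_road.
Qed.

Lemma social_cost_two_road d (z : routing R 2) :
  social_cost (two_road_game d) z =
  (1 + K * (z ord0).1) * ((z ord0).1 + (z ord0).2)
  + (1 + K * (z ord_max).2) * ((z ord_max).1 + (z ord_max).2).
Proof.
rewrite /social_cost /road_latency big_ord_recl big_ord1 /=.
by rewrite (_ : lift ord0 ord0 = ord_max) //; apply: val_inj.
Qed.

(** Every latency is at least [1], and at most [1 + K d] because no road carries
    more than [d] of the type that delays it. *)
Lemma social_cost_bounds d z : feasible (two_road_game d) z ->
  2 * d <= social_cost (two_road_game d) z <= 2 * d * (1 + K * d).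
Proof.
move=> /feasible_flows[[x0 x1 x_d] [y0 y1 y_d]]; rewrite social_cost_two_road.
have bound t w : 0 <= t -> t <= d -> 0 <= w ->
    w <= (1 + K * t) * w <= (1 + K * d) * w.
  move=> t0 t_d w0; rewrite ler_peMl ?lerDl ?mulr_ge0 //=.
  by rewrite ler_wpM2r // lerD2l ler_wpM2l.
have /andP[l0 u0] := bound (z ord0).1 ((z ord0).1 + (z ord0).2) x0
  ltac:(lra) ltac:(lra).
have /andP[l1 u1] := bound (z ord_max).2 ((z ord_max).1 + (z ord_max).2) y1
  ltac:(lra) ltac:(lra).
apply/andP; split; first lra.
apply: le_trans (lerD u0 u1) _; rewrite -mulrDr addrACA x_d y_d; lra.
Qed.

Definition separated (d : R) : routing R 2 :=
  fun i => if i == ord0 then (d, 0) else (0, d).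

Definition exchanged (d : R) : routing R 2 :=
  fun i => if i == ord0 then (0, d) else (d, 0).

Lemma social_cost_separated d :
  social_cost (two_road_game d) (separated d) = 2 * d * (1 + K * d).
Proof. by rewrite social_cost_two_road /=; lra. Qed.

Lemma social_cost_exchanged d :
  social_cost (two_road_game d) (exchanged d) = 2 * d.
Proof. by rewrite social_cost_two_road /=; lra. Qed.

(** Both roads have the latency [1 + K d], so nobody gains by switching. *)
Lemma separated_equilibrium d :
  0 <= d -> equilibrium (two_road_game d) (separated d).
Proof.
move=> d0; exists (flow_of (fun i => (separated d i).1)).
exists (flow_of (fun i => (separated d i).2)); split.
  by apply: realizes_flow_of; split=> //=; lra.
have latE j p : od_path (two_road_game d) j p ->
    path_latency (two_road_game d) (separated d) p = 1 + K * d.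
  by rewrite od_path_two_road => /orP[]/eqP->; rewrite /path_latency big_seq1.
by move=> j p q jp jq _; rewrite !(latE j).
Qed.

Lemma equilibrium_feasible d z :
  equilibrium (two_road_game d) z -> feasible (two_road_game d) z.
Proof. by move=> [f [h [fhz _]]]; exists f, h. Qed.

(** This equilibrium attains the upper bound on the cost of all routings. *)
Lemma separated_worst d :
  0 <= d -> worst_equilibrium (two_road_game d) (separated d).
Proof.
move=> d0; split=> [|z /equilibrium_feasible/social_cost_bounds/andP[_]].
  exact: separated_equilibrium.
by rewrite social_cost_separated.
Qed.

(** Every latency is [1], so the lower bound on the cost is attained. *)
Lemma exchanged_optimum d :
  0 <= d -> social_optimum (two_road_game d) (exchanged d).
Proof.
move=> d0; split=> [|z /social_cost_bounds/andP[+ _]].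
  by do 2!eexists; apply: realizes_flow_of; split=> //=; lra.
by rewrite social_cost_exchanged.
Qed.

Lemma worst_equilibrium_cost d z : 0 <= d ->
  worst_equilibrium (two_road_game d) z ->
  social_cost (two_road_game d) z = 2 * d * (1 + K * d).
Proof.
move=> d0 [eq_z max_z]; apply/eqP; rewrite eq_le -social_cost_separated.
have [eq_s max_s] := separated_worst d0.
by rewrite max_s ?max_z.
Qed.

Lemma social_optimum_cost d z : 0 <= d ->
  social_optimum (two_road_game d) z ->
  social_cost (two_road_game d) z = 2 * d.
Proof.
move=> d0 [f_z min_z]; apply/eqP; rewrite eq_le -(social_cost_exchanged d).
have [f_e min_e] := exchanged_optimum d0.
by rewrite min_e ?min_z.
Qed.

Lemma two_road_admissible d : 0 <= d -> admissible (two_road_game d).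
Proof.
move=> d0; split=> [j|i x y x0 y0|i x x' y x0 xx' y0|i x y y' x0 y0 yy'] //=.
- by rewrite addr_ge0 // mulr_ge0 //; case: ifP.
- by rewrite lerD2l ler_wpM2l //; case: ifP.
- by rewrite lerD2l ler_wpM2l //; case: ifP.
Qed.

Lemma two_road_price_of_anarchy :
  is_price_of_anarchy (two_road_game 1) (1 + K).
Proof.
exists (separated 1), (exchanged 1).
rewrite social_cost_separated social_cost_exchanged; split.
- exact: separated_worst.
- exact: exchanged_optimum.
- by rewrite mulr1.
- by rewrite !mulr1 mulrAC divff ?mul1r ?pnatr_eq0.
Qed.

(** At demand [g] the optimal cost is [2 g], which equals [2 (1 + K)] for
    exactly one [g]. *)
Lemma two_road_bicriteria : is_bicriteria (two_road_game 1) (1 + K).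
Proof.
have K1 : 0 <= 1 + K by rewrite addr_ge0.
have scaleE g : scale_demand g (two_road_game 1) = two_road_game g.
  by rewrite /scale_demand /= mulr1.
split=> [|g [g0 [ze [zo []]]]].
  split=> //; exists (separated 1), (exchanged (1 + K)); rewrite scaleE.
  split; [exact: separated_worst|exact: exchanged_optimum|].
  by rewrite social_cost_exchanged social_cost_separated !mulr1.
rewrite scaleE => /(worst_equilibrium_cost ler01)->.
move=> /(social_optimum_cost g0)->; lra.
Qed.

End TwoRoads.

Theorem proposition1 (R : realType) (M : R) :
  exists (V : finType) (n m : nat) (G : mixed_game R V n m),
    admissible G /\
    exists rho gamma : R,
      [/\ is_price_of_anarchy G rho, is_bicriteria G gamma,
          M < rho & M < gamma].
Proof.
have M_lt : M < 1 + `|M|.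
  by rewrite (le_lt_trans (ler_norm M)) // ltrDr.
exists bool, 2%N, 1%N, (two_road_game `|M| 1).
split; first exact: two_road_admissible.
exists (1 + `|M|), (1 + `|M|); split=> //.
- exact: two_road_price_of_anarchy.
- exact: two_road_bicriteria.
Qed.
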